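(* Let $X_t$ be a regular one-dimensional diffusion with values in $D=(l,r)$ as in the context, with continuous drift and diffusion functions, let $\rho>0$, and let $g:D\to\mathbb{R}$ be differentiable with $g(x_0)>0$ for some $x_0\in D$. Let $p^*\in(l,r)$. If $\tau_{p^*}$ is optimal in the problem $\sup_\tau\mathbf{E}^xg(X_\tau)e^{-\rho\tau}\mathbf{1}_{\{\tau<\infty\}}$ over the class $\mathcal{M}^l_{\rm th}$ (for all $x\in(l,r)$) and $g$ is twice differentiable at the point $p^*$, then the pair $(H(x),p^* )$, where $H(x)=h(p^* )\psi(x)$ for $l<x<p^*$ and $h(p)=g(p)/\psi(p)$, is a solution to the free-boundary problem described in the context, and $H''(p^*{-}0)\ge g''(p^* )$.
   Context: $X_t$, $t\ge0$, is a (continuous) diffusion process with values in $D=(l,r)$, $-\infty\le l<r\le+\infty$, with infinitesimal generator $\mathbb{L}f(x)=a(x)f'(x)+\frac12\sigma^2(x)f''(x)$, where $a:D\to\mathbb{R}$ and $\sigma:D\to(0,\infty)$ are continuous. The process is regular: from any $x\in(l,r)$ it reaches any $y\in(l,r)$ in finite time with positive probability. $\mathbf{E}^x$ denotes expectation for $X_0=x$. $\psi\in C^2(l,r)$ denotes the increasing positive fundamental solution (unique up to a positive multiplicative constant) of $\mathbb{L}u=\rho u$ on $(l,r)$ associated with $X$; it satisfies $\mathbf{E}^xe^{-\rho T_p}=\psi(x)/\psi(p)$ for $x<p$, where $T_p=\inf\{t\ge0:X_t=p\}$. For $p\in(l,r)$, $\tau_p=\inf\{t\ge0: X_t\ge p\}$,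 and $\mathcal{M}^l_{\rm th}=\{\tau_p:\ p\in(l,r)\}$. Free-boundary problem: find a threshold $\bar p\in(l,r)$ and a bounded twice differentiable function $H(x)$, $l<x<\bar p$, such that $$\mathbb{L}H(x)=\rho H(x)\ \ (l<x<\bar p),\qquad H(\bar p-0)=g(\bar p),\qquad H'(\bar p-0)=g'(\bar p).$$ *)

(* Defs.v *)
From HB Require Import structures.
From mathcomp Require Import all_boot all_order all_algebra.
From mathcomp Require Import all_classical all_reals all_analysis.
From mathcomp Require Import measurable_realfun.
Set Implicit Arguments.
Unset Strict Implicit.
Unset Printing Implicit Defensive.
Import Order.TTheory GRing.Theory Num.Theory.
Import numFieldNormedType.Exports.
Local Open Scope ring_scope.
Local Open Scope classical_set_scope.

(** Functions on the state space [(l, r)] are represented by total functions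
    [R -> R]; only their values on [(l, r)] matter. *)

Definition dom (R : realType) (l r : \bar R) : set R :=
  [set x | (l < x%:E < r)%E].

Definition C2_on (R : realType) (D : set R) (f : R -> R) : Prop :=
  forall x, D x ->
    [/\ derivable f x 1, derivable f^`() x 1 & {for x, continuous f^`(2)}].

Definition genL (R : realType) (a sigma : R -> R) (f : R -> R) (x : R) : R :=
  a x * (f^`())%classic x + 2^-1 * sigma x ^+ 2 * (f^`(2))%classic x.

(** C^2 functions with compact support in [D], extended by 0 to [R]; [D] is an
    interval, so it contains [[u, v]]. *)
Definition test_fun (R : realType) (D : set R) (f : R -> R) : Prop :=
  C2_on setT f /\
  exists u v, [/\ D u, D v & forall x, f x != 0 -> u <= x <= v].

Section process.
Context (R : realType) (d : measure_display) (Om : measurableType d).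
Variables (P : R -> probability Om R) (X : R -> Om -> R).

(** Only the times [t >= 0] of [X : R -> Om -> R] are meaningful.  A random
    time takes its values in [\bar R], with [+oo] for "never". *)

Definition nat_filtration (t : R) : set (set Om) :=
  <<s [set A | exists (s : R) (B : set R),
    [/\ 0 <= s <= t, measurable B & A = X s @^-1` B]] >>.

Definition stopping_time (tau : Om -> \bar R) : Prop :=
  (forall w, (0 <= tau w)%E) /\
  forall t : R, 0 <= t -> nat_filtration t [set w | (tau w <= t%:E)%E].

Definition stopped_events (tau : Om -> \bar R) : set (set Om) :=
  [set A | measurable A /\
    forall t : R, 0 <= t -> nat_filtration t (A `&` [set w | (tau w <= t%:E)%E])].

Definition finite_time (tau : Om -> \bar R) : set Om :=
  [set w | (tau w < +oo)%E].

(** [X_tau]; meaningless outside [finite_time tau]. *)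
Definition value_at (tau : Om -> \bar R) (w : Om) : R := X (fine (tau w)) w.

Definition strong_markov (D : set R) : Prop :=
  (forall (t : R) (B : set R), 0 <= t -> measurable B ->
     measurable_fun D (fun x : R => P x (X t @^-1` B))) /\
  forall x tau A (t : R) (B : set R),
    D x -> stopping_time tau -> stopped_events tau A -> 0 <= t -> measurable B ->
    P x (A `&` finite_time tau `&` [set w | B (X (fine (tau w) + t) w)]) =
    (\int[P x]_(w in A `&` finite_time tau)
        P (value_at tau w) (X t @^-1` B))%E.

Definition hit (p : R) (w : Om) : \bar R :=
  ereal_inf (EFin @` [set t | 0 <= t /\ X t w = p]).

Definition thresh (p : R) (w : Om) : \bar R :=
  ereal_inf (EFin @` [set t | 0 <= t /\ p <= X t w]).

(** [P x] is the law under [X_0 = x]; a diffusion is a strong Markov process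
    with continuous paths, and [genL a sigma] is its infinitesimal generator
    on the functions of class C^2 with compact support. *)
Record is_diffusion (D : set R) (a sigma : R -> R) : Prop := IsDiffusion {
  diffusion_meas : forall t : R, 0 <= t -> measurable_fun setT (X t);
  diffusion_state : forall (t : R) w, 0 <= t -> D (X t w);
  diffusion_paths : forall w,
    {within [set t : R | 0 <= t], continuous (fun t => X t w)};
  diffusion_start : forall x, D x -> P x (X 0 @^-1` [set x]) = 1%E;
  diffusion_markov : strong_markov D;
  diffusion_generator : forall f x, test_fun D f -> D x ->
    t^-1 * ((\int[P x]_w f (X t w)) - f x) @[t --> 0^'+]
      --> genL a sigma f x }.

Definition regular_process (D : set R) : Prop :=
  forall x y, D x -> D y -> (0 < P x (finite_time (hit y)))%E.

(** The increasing fundamental solution of [L u = rho u].  Which increasing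
    solution is associated with [X] is fixed by the Laplace transform of the
    hitting times; [expeR -oo = 0] accounts for the paths that never hit. *)
Record increasing_fundamental (D : set R) (a sigma : R -> R) (rho : R)
    (psi : R -> R) : Prop := IncreasingFundamental {
  fundamental_C2 : C2_on D psi;
  fundamental_gt0 : forall x, D x -> 0 < psi x;
  fundamental_incr : forall x y, D x -> D y -> x < y -> psi x < psi y;
  fundamental_eq : forall x, D x -> genL a sigma psi x = rho * psi x;
  fundamental_laplace : forall x p, D x -> D p -> x < p ->
    (\int[P x]_w expeR (- (rho%:E * hit p w)) = (psi x / psi p)%:E)%E }.

(** The expected discounted payoff [E^x g(X_tau) e^{-rho tau} 1_{tau < oo}]. *)
Definition payoff (g : R -> R) (rho : R) (x : R) (tau : Om -> \bar R)
    : \bar R :=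
  (\int[P x]_w (g (value_at tau w) * expR (- (rho * fine (tau w)))
                 * \1_(finite_time tau) w)%:E)%E.

Definition thresholds (D : set R) : set (Om -> \bar R) := thresh @` D.

Definition optimal_in (M : set (Om -> \bar R)) (D : set R) (g : R -> R)
    (rho : R) (tau : Om -> \bar R) : Prop :=
  M tau /\ forall x, D x ->
    payoff g rho x tau = ereal_sup (payoff g rho x @` M).

End process.

(** [H] is a function on [(l, p)]: its values elsewhere are not constrained.
    [H(p-0)] and [H'(p-0)] are the left limits of [H] and [H'] at [p]. *)
Record solves_free_boundary (R : realType) (l r : \bar R) (a sigma : R -> R)
    (rho : R) (g : R -> R) (H : R -> R) (p : R) : Prop := SolvesFreeBoundary {
  fb_threshold : dom l r p;
  fb_bounded : exists M : R, forall x, dom l p%:E x -> `|H x| <= M;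
  fb_diff : forall x, dom l p%:E x ->
    derivable H x 1 /\ derivable H^`() x 1;
  fb_eq : forall x, dom l p%:E x -> genL a sigma H x = rho * H x;
  fb_fit : H x @[x --> p^'-] --> g p;
  fb_smooth : H^`() x @[x --> p^'-] --> g^`() p }.

(* Main.v *)
(** From [x < p] the process enters [[p, r)] exactly when it hits [p], so the
    payoff of [thresh p] at [x] is [h p * psi x] with [h = g / psi].  Starting
    below both [p] and [p*], optimality gives [h p <= h p*]; hence
    [g - h p* * psi] is nonpositive on [(l, r)] and vanishes at [p*].  The
    first- and second-order conditions at this interior maximum are the smooth
    fit and the inequality on the second derivatives. *)
Require Import Defs.
From HB Require Import structures.
From mathcomp Require Import all_boot all_order all_algebra.
From mathcomp Require Import all_classical all_reals all_analysis.
From mathcomp Require Import measurable_realfun.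
From mathcomp Require Import ring lra.
Import Order.TTheory GRing.Theory Num.Theory.
Import numFieldNormedType.Exports.
Local Open Scope ring_scope.
Local Open Scope classical_set_scope.

Set Implicit Arguments.
Unset Strict Implicit.

(** * Comparison of integrals on an event of full measure, for integrands not assumed measurable *)

Section integral_without_measurability.
Local Open Scope ereal_scope.
Import HBNNSimple.
Context d (T : measurableType d) (R : realType).
Context (mu : {measure set T -> \bar R}) (E : set T).
Hypotheses (mE : measurable E) (muE : mu (~` E) = 0).

(** Cutting a simple function off outside [E] changes it only on a null set. Simple functions are
    measurable, so almost-everywhere equality of integrals applies to them. *)
Lemma sintegral_scale_proj (h : {nnsfun T >-> R}) (c : R) (c0 : (0 <= c)%R) :
  sintegral mu (scale_nnsfun (proj_nnsfun h mE) c0) = c%:E * sintegral mu h.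
Proof.
rewrite -[scale_nnsfun _ _ : T -> R]/((cst c \* proj_nnsfun h mE)%R : T -> R).
rewrite sintegralrM; congr (_ * _).
rewrite -!integralT_nnsfun; apply: ge0_ae_eq_integral => //.
- exact/measurable_EFinP/measurable_funTS.
- exact/measurable_EFinP/measurable_funTS.
- by move=> t _; rewrite lee_fin.
- by move=> t _; rewrite lee_fin.
exists (~` E); split; [exact: measurableC|by []|].
move=> t /= /not_implyP[_ nE] Et; apply: nE.
by rewrite mindicE mem_set// mulr1.
Qed.

(** The integral of a nonnegative function is the supremum of the integrals of the simple functions
    below it, measurable or not. If [h] lies below [f1], then [c] times [h] cut off to [E] lies
    below [f2] everywhere. *)
Lemma ge0_le_integral_scale (c : R) (f1 f2 : T -> \bar R) :
  (0 <= c)%R -> (forall t, 0 <= f1 t) -> (forall t, 0 <= f2 t) ->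
  (forall t, E t -> c%:E * f1 t <= f2 t) ->
  c%:E * \int[mu]_t f1 t <= \int[mu]_t f2 t.
Proof.
move=> c0 f10 f20 f12.
have [->|cN0] := eqVneq c 0%R; first by rewrite mul0e integral_ge0.
have {cN0}c0' : (0 < c)%R by rewrite lt_neqAle eq_sym cN0.
rewrite !ge0_integralTE// -lee_pdivlMl//; apply: ge_ereal_sup => _ [h hf <-].
rewrite lee_pdivlMl// -sintegral_scale_proj.
apply: ereal_sup_ubound; eexists; last by reflexivity.
move=> t /=; rewrite mindicE; have [/set_mem Et|_] := boolP (t \in E).
  by rewrite mulr1 EFinM (le_trans _ (f12 _ Et))// lee_pmul2l.
by rewrite !mulr0.
Qed.

(** The previous comparison with factor 1 is applied to positive and negative parts; exchanging [f1]
    and [f2] gives the reverse inequalities. *)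
Lemma eq_integral_full (f1 f2 : T -> \bar R) :
  (forall t, E t -> f1 t = f2 t) -> \int[mu]_t f1 t = \int[mu]_t f2 t.
Proof.
wlog suff le : f1 f2 / (forall t, E t -> f1 t = f2 t) ->
    \int[mu]_t f1^\+ t <= \int[mu]_t f2^\+ t /\
    \int[mu]_t f1^\- t <= \int[mu]_t f2^\- t.
  move=> f12; have [p12 n12] := le _ _ f12.
  have [p21 n21] := le f2 f1 (fun t Et => esym (f12 t Et)).
  rewrite integralE [RHS]integralE.
  by congr (_ - _); apply: le_anti; apply/andP.
move=> f12; split; rewrite -[leLHS]mul1e;
  apply: ge0_le_integral_scale => // t Et;
  by rewrite mul1e ?(funeposE, funenegE) f12.
Qed.

End integral_without_measurability.

(** For [c > 0], the scaled comparison with [c] gives one inequality and with the inverse of [c] the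
    other; a negative [c] reduces to [-c]. *)
Lemma integralZl_ge0 d (T : measurableType d) (R : realType)
    (mu : {measure set T -> \bar R}) (c : R) (f : T -> \bar R) :
  (forall t, 0 <= f t)%E ->
  (\int[mu]_t (c%:E * f t) = c%:E * \int[mu]_t f t)%E.
Proof.
move=> f0; wlog c0 : c / 0 <= c.
  move=> ge0Z; have [|/ltW c0] := leP 0 c; first exact: ge0Z.
  rewrite -[c]opprK EFinN; under eq_integral do rewrite mulNe.
  rewrite integral_ge0N ?ge0Z ?mulNe ?oppr_ge0//.
  by move=> t _; rewrite mule_ge0// lee_fin oppr_ge0.
have full : mu (~` setT) = 0%E by rewrite setCT measure0.
apply: le_anti; apply/andP; split; last first.
  by apply: (ge0_le_integral_scale measurableT full) => // t; rewrite mule_ge0.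
have [->|cN0] := eqVneq c 0.
  by under eq_integral do rewrite mul0e; rewrite integral0 mul0e.
have {cN0}c0' : 0 < c by rewrite lt_neqAle eq_sym cN0.
rewrite -lee_pdivrMl//; apply: (ge0_le_integral_scale measurableT full) => //.
- by rewrite invr_ge0.
- by move=> t; rewrite mule_ge0.
- by move=> t _; rewrite muleA -EFinM mulVf ?mul1e// gt_eqF.
Qed.

(** * Hitting times along a single continuous path *)

Section hitting.
Context (R : realType) d (Om : measurableType d) (X : R -> Om -> R) (w : Om).
Hypothesis cX : {within [set t : R | 0 <= t], continuous (fun t => X t w)}.

(** By the intermediate value theorem, a path starting below [p] takes the value [p] no later than
    any time at which it is at least [p]. *)
Lemma thresh_hit (p : R) : X 0 w < p -> thresh X p w = hit X p w.
Proof.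
move=> X0p; apply: le_anti; apply/andP; split.
  apply: ereal_inf_le_tmp => _ [t [t0 Xt] <-]; exists t => //.
  by split=> //; rewrite Xt.
apply: le_ereal_inf_tmp => _ [t [t0 pXt] <-].
have [||s] := @IVT R (fun t => X t w) 0 t p t0.
- apply: continuous_subspaceW cX => s /=.
  by rewrite in_itv /= => /andP[].
- by rewrite ge_min le_max pXt (ltW X0p) orbT.
rewrite in_itv /= => /andP[s0 st] Xs.
by apply: (@le_trans _ _ s%:E); [apply: ereal_inf_lbound; exists s|].
Qed.

Lemma closed_level (p : R) : closed [set t | 0 <= t /\ X t w = p].
Proof.
(* Freezing the path at its initial value for negative times turns continuity on the half-line into
   continuity on the whole line. *)
pose Y t := X (Num.max 0 t) w.
have cY : continuous Y.
  move=> t; have := cX; rewrite subspace_continuousP => /(_ (Num.max 0 t)).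
  have max0 s : 0 <= Num.max 0 s :> R by rewrite le_max lexx.
  move=> /(_ (max0 t)) cXt A /cXt; rewrite /= => nA.
  have c0 : {for t, continuous (cst 0 : R -> R^o)} by exact: cst_continuous.
  have c1 : {for t, continuous (id : R -> R^o)} by exact: cvg_id.
  have := continuous_max c0 c1.
  move=> /(_ _ nA) nM.
  rewrite /nbhs /=; apply: (@filterS _ (nbhs t) _
    [set s | 0 <= Num.max 0 s -> A (X (Num.max 0 s) w)] _ _ nM).
  by move=> s /= /(_ (max0 s)).
rewrite (_ : mkset _ = [set t | 0 <= t] `&` (Y @^-1` [set p])).
  apply: closedI; first exact: closed_ge.
  by move/continuous_closedP : cY; apply; exact: closed_eq.
by apply/seteqP; split=> t [t0]; rewrite /= /Y max_r.
Qed.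

Lemma hit_ge0 (p : R) : (0 <= hit X p w)%E.
Proof. by apply: le_ereal_inf_tmp => _ [t [t0 _] <-]; rewrite lee_fin. Qed.

(** The set of times spent at [p] is closed and bounded below, so when nonempty it contains its
    infimum. *)
Lemma value_at_hit (p : R) : (hit X p w < +oo)%E -> X (fine (hit X p w)) w = p.
Proof.
rewrite /hit; set S := mkset _ => hity.
have [S0|nS] := pselect (S !=set0); last first.
  move: hity; rewrite (_ : S = set0) ?image_set0 ?ereal_inf0 ?ltxx//.
  by apply/seteqP; split=> // t St; apply: nS; exists t.
have lS : has_lbound S by exists 0 => t [].
rewrite ereal_inf_EFin //=.
suff : S (inf S) by case.
apply: (itv_closed_infimums S0 (@closed_level p)).
split; first exact/ge_inf.
by move=> y; exact: lb_le_inf.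
Qed.

End hitting.

(** The second derivative exists only at [p]. Were it positive, f' would be positive just to the
    right of [p], and the mean value theorem would give a value above the maximum. *)
Lemma derive1_le0_at_max (R : realType) (f : R -> R) (a b p : R) :
  p \in `]a, b[%R -> (forall t, t \in `]a, b[%R -> derivable f t 1) ->
  derivable f^`() p 1 -> (forall t, t \in `]a, b[%R -> f t <= f p) ->
  f^`() p = 0 /\ f^`(2) p <= 0.
Proof.
move=> pab df ddf fmax.
have /andP[ap pb] : a < p < b by move: pab; rewrite in_itv.
have f'p : f^`() p = 0.
  rewrite derive1E; apply: derive_val.
  by apply: (derive1_at_max (ltW (lt_trans ap pb))).
split=> //; rewrite leNgt; apply/negP => f''p.
have /(cvgr_gt _) :
    h^-1 *: ((f^`()%classic \o shift p) (h *: 1) - f^`()%classic p) @[h --> 0^']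
    --> f^`(2) p.
  rewrite -[f^`(2) p]/(f^`()^`() p) [f^`()^`() p]derive1E; exact: ddf.
move=> /(_ _ f''p) /nbhs_ballP[e /= e0 f'_gt0].
have [q [pq qe qb]] : exists q, [/\ p < q, q < p + e & q < b].
  have pc : p < Num.min (p + e) b by rewrite lt_min ltrDl e0.
  exists ((p + Num.min (p + e) b) / 2).
  by have := midf_lt pc; rewrite lt_min => -[-> /andP[-> ->]].
have inab t : p <= t -> t <= q -> t \in `]a, b[%R.
  by move=> pt tq; rewrite in_itv /= (lt_le_trans ap pt) (le_lt_trans tq qb).
have fder t : t \in `]a, b[%R -> is_derive t 1 f (f^`() t).
  by move=> tab; rewrite derive1E; apply: derivableP; exact: df.
have df_pq (t : R) : t \in `]p, q[%R -> is_derive t 1 f (f^`() t).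
  by rewrite in_itv /= => /andP[/ltW pt /ltW tq]; exact/fder/inab.
have cf_pq : {within `[p, q], continuous f}.
  apply: derivable_within_continuous => t; rewrite in_itv /= => /andP[pt tq].
  exact/df/inab.
have [t] := @MVT R f (derive1 f) p q pq df_pq cf_pq.
rewrite in_itv /= => /andP[pt tq] ftq.
have : f q <= f p by apply/fmax/inab; rewrite ?lexx ?ltW.
rewrite leNgt -subr_gt0 ftq mulr_gt0 ?subr_gt0//.
(* As f'(p) = 0, the difference quotient of f' at [p] with increment [t - p] is f'(t) / (t - p). *)
have := f'_gt0 (t - p); rewrite /= f'p subr0 [_%:A]mulr1 subrK.
rewrite /ball /= sub0r normrN gtr0_norm ?subr_gt0// subr_eq0 gt_eqF//.
rewrite pmulr_rgt0 ?invr_gt0 ?subr_gt0//; apply=> //; lra.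
Qed.

(* [hit X p] is not known to be measurable, so the integrals are compared
   through lemmas that do not ask for it. *)
Lemma payoff_thresh (R : realType) d (Om : measurableType d)
    (P : R -> probability Om R) (X : R -> Om -> R) (D : set R)
    (a sigma : R -> R) (rho : R) (psi g : R -> R) (x p : R) :
  is_diffusion P X D a sigma -> 0 < rho ->
  increasing_fundamental P X D a sigma rho psi ->
  D x -> D p -> x < p ->
  payoff P X g rho x (thresh X p) = (g p / psi p * psi x)%:E.
Proof.
move=> hX rho0 hpsi Dx Dp xp.
have mE : measurable (X 0 @^-1` [set x]).
  rewrite -[_ @^-1` _]setTI; apply: (diffusion_meas hX (lexx 0)) => //.
have PE : P x (~` (X 0 @^-1` [set x])) = 0%E.
  by rewrite probability_setC // (diffusion_start hX Dx) subee.
(* The two integrands are compared only on the full-measure event that the path starts at [x]. *)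
rewrite /payoff (eq_integral_full mE PE
  (f2 := fun w => ((g p)%:E * expeR (- (rho%:E * hit X p w)))%E)); last first.
  move=> w /= X0.
  have cX : {within [set t : R | 0 <= t], continuous (fun t => X t w)}.
    exact: (diffusion_paths hX).
  have thit : thresh X p w = hit X p w by apply: (thresh_hit cX); rewrite X0.
  rewrite /value_at /finite_time indicE.
  have := hit_ge0 X w p; have := value_at_hit cX (p := p).
  rewrite -thit; case tE : (thresh X p w) => [t| |] //=.
    by rewrite ltry => -> // _; rewrite mem_set ?mulr1 //= tE ltry.
  (* On a path that never hits [p], both sides vanish: the indicator is 0, and so is [expeR] at
     minus infinity. *)
  by move=> _ _; rewrite memNset ?mulr0 /= ?tE// gt0_muley ?mule0 ?lte_fin.
rewrite integralZl_ge0; last by move=> w; exact: expeR_ge0.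
by rewrite (fundamental_laplace hpsi)// -EFinM mulrA mulrAC.
Qed.

(** * Neighbourhoods inside an interval with extended real endpoints *)

Lemma lte_exists_lt (R : realType) (l : \bar R) (p : R) :
  (l < p%:E)%E -> exists2 x : R, (l < x%:E)%E & x < p.
Proof.
case: l => [l| |] // lp; last by exists (p - 1); rewrite ?ltNyr// ltrBlDr ltrDl.
by exists ((l + p) / 2); rewrite ?lte_fin; have := midf_lt lp => -[].
Qed.

Lemma gte_exists_gt (R : realType) (r : \bar R) (p : R) :
  (p%:E < r)%E -> exists2 x : R, (x%:E < r)%E & p < x.
Proof.
rewrite -lteN2 -EFinN => /lte_exists_lt[x rx xp].
by exists (- x); [rewrite EFinN lteNl|rewrite ltrNr].
Qed.

Lemma nbhs_dom (R : realType) (l r : \bar R) (p : R) :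
  dom l r p -> \forall x \near p, dom l r x.
Proof.
move=> /andP[/lte_exists_lt[u lu up] /gte_exists_gt[v vr pv]].
near=> x; apply/andP; split.
- apply: (lt_trans lu); rewrite lte_fin; near: x; exact: lt_nbhsr.
- apply: (lt_trans _ vr); rewrite lte_fin; near: x; exact: lt_nbhsl.
Unshelve. all: by end_near. Qed.

Lemma at_left_dom (R : realType) (l r : \bar R) (p : R) :
  dom l r p -> \forall x \near p^'-, dom l p%:E x.
Proof.
move=> /andP[/lte_exists_lt[u lu up] _].
near=> x; apply/andP; split; last first.
  by rewrite lte_fin; near: x; exact: nbhs_left_lt.
by apply: (lt_trans lu); rewrite lte_fin; near: x; exact: nbhs_left_gt.
Unshelve. all: by end_near. Qed.

Lemma dom_itv (R : realType) (l r : \bar R) (p : R) : dom l r p ->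
  exists a b, p \in `]a, b[%R /\ forall t, t \in `]a, b[%R -> dom l r t.
Proof.
move=> /andP[/lte_exists_lt[u lu up] /gte_exists_gt[v vr pv]].
exists u, v; split=> [|t]; rewrite in_itv /= ?up// => /andP[ut tv].
apply/andP; split; first by apply: (lt_trans lu); rewrite lte_fin.
by apply: (lt_trans _ vr); rewrite lte_fin.
Qed.

Lemma derivable_mull (R : realType) (c : R) (f : R -> R) (x : R) :
  derivable f x 1 -> derivable (fun y => c * f y) x 1.
Proof. by move=> df; have := @derivableZ _ _ _ f c x 1 df. Qed.

Theorem proposition1 (R : realType) (d : measure_display)
    (Om : measurableType d) (P : R -> probability Om R) (X : R -> Om -> R)
    (l r : \bar R) (a sigma : R -> R) (rho : R) (psi g : R -> R) (pstar : R)
    (hlr : (l < r)%E)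
    (ha : forall x, dom l r x -> {for x, continuous a})
    (hsigma : forall x, dom l r x -> {for x, continuous sigma})
    (hsigma0 : forall x, dom l r x -> 0 < sigma x)
    (hX : is_diffusion P X (dom l r) a sigma)
    (hreg : regular_process P X (dom l r))
    (hrho : 0 < rho)
    (hpsi : increasing_fundamental P X (dom l r) a sigma rho psi)
    (hg : forall x, dom l r x -> derivable g x 1)
    (hg0 : exists2 x0, dom l r x0 & 0 < g x0)
    (hpstar : dom l r pstar)
    (hopt : optimal_in P X (thresholds X (dom l r)) (dom l r) g rho
              (thresh X pstar))
    (hg2 : derivable g^`() pstar 1) :
  forall H : R -> R,
    (forall x, dom l pstar%:E x -> H x = g pstar / psi pstar * psi x) ->
    solves_free_boundary l r a sigma rho g H pstar /\
    exists2 H2 : R, H^`(2) x @[x --> pstar^'-] --> H2 & g^`(2) pstar <= H2.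
Proof.
move=> H HE; set c := g pstar / psi pstar in HE.
have psi_gt0 := fundamental_gt0 hpsi; have psi_C2 := fundamental_C2 hpsi.
have gpstar : g pstar = c * psi pstar by rewrite /c divfK// gt_eqF// psi_gt0.
have /andP[lp pr] := hpstar.
have subD x : dom l pstar%:E x -> dom l r x.
  by move=> /andP[lx xp]; apply/andP; split=> //; exact: lt_trans xp pr.
have g_le p : dom l r p -> g p <= c * psi p.
  move=> Dp; have /andP[lp' _] := Dp.
  (* A starting point below both thresholds makes the payoff formula valid for each; the common
     factor [psi x] then cancels. *)
  have : (l < (Num.min p pstar)%:E)%E by rewrite EFin_min lt_min lp' lp.
  move=> /lte_exists_lt[x lx]; rewrite lt_min => /andP[xp xpstar].
  have Dx : dom l r x by apply: subD; apply/andP; split.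
  have sup_eq := hopt.2 x Dx.
  rewrite (payoff_thresh g hX hrho hpsi Dx hpstar xpstar) in sup_eq.
  have : (payoff P X g rho x (thresh X p) <= (c * psi x)%:E)%E.
    by rewrite sup_eq; apply: ereal_sup_ubound; do 2 eexists; last by [].
  rewrite (payoff_thresh g hX hrho hpsi Dx Dp xp) lee_fin.
  by rewrite ler_pM2r ?psi_gt0// ler_pdivrMr ?psi_gt0.
pose f := g - (fun x => c * psi x).
have [u [v [puv Duv]]] := dom_itv hpstar.
have dpsi x : dom l r x -> derivable psi x 1 by move=> /psi_C2[].
have ddpsi x : dom l r x -> derivable psi^`() x 1 by move=> /psi_C2[].
pose df := g^`()%classic - (fun x => c * psi^`()%classic x).
have f'E : \forall x \near pstar, df x = f^`() x.
  apply: filterS (nbhs_dom hpstar) => x Dx.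
  rewrite [RHS]derive1E deriveB; [|exact: hg|exact/derivable_mull/dpsi].
  by rewrite -!derive1E (derive1Ml c (dpsi _ Dx)).
have [f'0 f''0] : f^`() pstar = 0 /\ f^`(2) pstar <= 0.
  apply: (derive1_le0_at_max puv).
  - move=> t /Duv Dt; apply: derivableB; first exact: hg.
    exact/derivable_mull/dpsi.
  - apply: near_eq_derivable f'E _.
    by apply: derivableB; [exact: hg2|exact/derivable_mull/ddpsi].
  - move=> t /Duv Dt; rewrite /f /= !fctE -gpstar subrr subr_le0; exact: g_le.
have g'E : g^`() pstar = c * psi^`()%classic pstar.
  by apply/eqP; rewrite -subr_eq0 -f'0 -(nbhs_singleton f'E).
have g''E : g^`(2) pstar <= c * psi^`(2)%classic pstar.
  (* The comparison with the second derivative of [f] is in fact an equality, obtained by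
     differentiating [df], which agrees with f' near [pstar]. *)
  rewrite -subr_le0; apply: le_trans f''0; rewrite le_eqVlt; apply/orP; left.
  rewrite !derive1nS /= !derive1E -(near_eq_derive (1 : R) f'E).
  rewrite (deriveB hg2 (derivable_mull (ddpsi _ hpstar))).
  by rewrite -!derive1E (derive1Ml c (ddpsi _ hpstar)).
(* [H] is prescribed only to the left of [pstar]; this interval is open, so local equality there
   determines its derivatives. *)
have nearH x : dom l pstar%:E x -> \forall y \near x, c * psi y = H y.
  by move=> /nbhs_dom; apply: filterS => y /HE.
have H'E x : dom l pstar%:E x -> H^`() x = c * psi^`()%classic x.
  move=> Dx; rewrite derive1E -(near_eq_derive (1 : R) (nearH _ Dx)) -derive1E.
  exact/derive1Ml/dpsi/subD.
have nearH' x : dom l pstar%:E x ->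
    \forall y \near x, c * psi^`()%classic y = H^`() y.
  by move=> /nbhs_dom; apply: filterS => y /H'E.
have H''E x : dom l pstar%:E x -> H^`(2) x = c * psi^`(2)%classic x.
  move=> Dx; rewrite !derive1nS /= derive1E.
  rewrite -(near_eq_derive (1 : R) (nearH' _ Dx)) -derive1E.
  exact/derive1Ml/ddpsi/subD.
have leftD := at_left_dom hpstar.
have cont (h : R -> R) : derivable h pstar 1 -> {for pstar, continuous h}.
  by move=> /derivable1_diffP; exact: differentiable_continuous.
(* Serves the left limits of [H], H' and H'' alike, with [h] being [psi] or one of its
   derivatives. *)
have left_cvg (h k : R -> R) : (forall x, dom l pstar%:E x -> k x = c * h x) ->
    {for pstar, continuous h} -> k x @[x --> pstar^'-] --> c * h pstar.
  move=> kE ch; apply: (@cvg_trans _ ((fun x => c * h x) @ pstar^'-)).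
    by apply: near_eq_cvg; apply: filterS leftD => x /kE.
  by apply: cvgMr; exact: cvg_at_left_filter.
split; last first.
  exists (c * psi^`(2)%classic pstar); last exact: g''E.
  by apply: left_cvg H''E _; case: (psi_C2 _ hpstar).
split; first exact: hpstar.
(* The bound holds because [psi] is positive and increasing. *)
- exists (`|c| * psi pstar) => x Dx; rewrite HE// normrM ler_wpM2l//.
  rewrite (gtr0_norm (psi_gt0 _ (subD _ Dx))); move: (Dx) => /andP[_ xp].
  exact/ltW/(fundamental_incr hpsi (subD _ Dx) hpstar).
- move=> x Dx; split.
    apply: near_eq_derivable (nearH x Dx) _.
    exact: derivable_mull (dpsi _ (subD _ Dx)).
  apply: near_eq_derivable (nearH' x Dx) _.
  exact: derivable_mull (ddpsi _ (subD _ Dx)).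
- move=> x Dx; rewrite /genL H'E// H''E// HE//.
  rewrite [RHS]mulrCA -(fundamental_eq hpsi (subD _ Dx)) /genL; ring.
- by rewrite gpstar; apply: left_cvg HE _; exact/cont/dpsi.
- by rewrite g'E; apply: left_cvg H'E _; exact/cont/ddpsi.
Qed.
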